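(* Consider a family of search instances as described in the context, indexed by database sizes $N\to\infty$, with a fixed $E>0$, and assume basic confidence in every instance, i.e. $A_j\cap\mathcal T\neq\emptyset$ for every $j=1,\dots,n$. If $l+R=O(N^\delta)$ for some (small) $\delta>0$, where $l+R$ is the number of distinct elements of $A_1\cup\dots\cup A_n$, then the search task for the first item is completed in time duration $$T=O\big(n^{1/2}N^{\delta/2}\big),$$ where $n$ is the number of information sets $A_1,\dots,A_n$ (which, like $l$, $R$ and the $A_j$, may vary with the instance; the implied constant depends only on $E$ and the constant in $l+R=O(N^\delta)$).
   Context: A search instance: $\bar A$ is a finite set of $N$ objects, and $\mathcal H$ is an $N$-dimensional complex Hilbert space with orthonormal basis $\{|w\rangle: w\in\bar A\}$. The target set is $\mathcal T=\{w_1,\dots,w_l\}\subset\bar A$ ($l$ distinct elements) and $\mathcal L=\mathrm{span}\{|w_1\rangle,\dots,|w_l\rangle\}$. There are $n\ge1$ (possibly overlapping) finite information sets $A_1,\dots,A_n\subset\bar A$ with $\mathcal T\subseteq A_1\cup\dots\cup A_n$, and reliability coefficients $\alpha_1,\dots,\alpha_n>0$ with $\sum_{j=1}^n\alpha_j=1$. Let $w_{l+1},\dots,w_{l+R}$ be the distinct elements of $(A_1\cup\dots\cup A_n)\setminus\mathcal T$. The initial state is the unit vector $$|s\rangle=\frac1\nu\sum_{j=1}^n\alpha_j\sum_{w\in A_j}|w\rangle=\sum_{i=1}^{l+R}\beta_i|w_i\rangle,\qquad \beta_i=\frac1\nu\sum_{j:\,w_i\in A_j}\alpha_j,$$ where $\nu>0$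 is the normalization constant making $\||s\rangle\|=1$, and $y=(\sum_{i=1}^l\beta_i^2)^{1/2}$. The search evolves by $i\frac{d}{dt}|\psi(t)\rangle=H|\psi(t)\rangle$, $|\psi(0)\rangle=|s\rangle$, with $H=E\sum_{j=1}^{l}|w_j\rangle\langle w_j|+E|s\rangle\langle s|$. The search task for the first item is completed at time $T=\frac{\pi}{2Ey}$, at which $|\psi(T)\rangle\in\mathcal L$, so that a measurement in the basis $\{|w\rangle\}$ yields an element of $\mathcal T$ with probability $1$. *)

(* Defs.v *)
From HB Require Import structures.
From mathcomp Require Import all_boot all_order all_algebra.
From mathcomp Require Import all_classical all_reals all_analysis.
From mathcomp Require Import complex.
Set Implicit Arguments.
Unset Strict Implicit.
Unset Printing Implicit Defensive.
Import Order.TTheory GRing.Theory Num.Theory.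
Import numFieldNormedType.Exports.
Local Open Scope ring_scope.
Local Open Scope complex_scope.
Local Open Scope sesquilinear_scope.

(* The N objects are labelled by 'I_N; the Hilbert space is 'cV[R[i]]_N, and
   its distinguished orthonormal basis is the canonical one. *)
Record search_instance (R : realType) := SearchInstance {
  db_size : nat;
  nb_info : nat;
  target : {set 'I_db_size};
  info : 'I_nb_info -> {set 'I_db_size};
  alpha : 'I_nb_info -> R;
  nb_info_gt0 : (0 < nb_info)%N;
  target_covered : target \subset \bigcup_(j < nb_info) info j;
  alpha_gt0 : forall j, 0 < alpha j;
  alpha_sum1 : \sum_(j < nb_info) alpha j = 1
}.

Definition hnorm (R : realType) (N : nat) (v : 'cV[R[i]]_N) : R :=
  Num.sqrt (\sum_(w < N) ComplexField.Normc.normc (v w 0) ^+ 2).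

Definition ket (R : realType) (N : nat) (w : 'I_N) : 'cV[R[i]]_N :=
  delta_mx w 0.

(* |v><v| *)
Definition ketbra (R : realType) (N : nat) (v : 'cV[R[i]]_N) : 'M[R[i]]_N :=
  v *m v ^t*.

(* derivative at t of a curve in the complex space, the real and imaginary
   parts of each coordinate being differentiated separately *)
Definition is_vderive (R : realType) (N : nat)
    (psi : R -> 'cV[R[i]]_N) (t : R) (dpsi : 'cV[R[i]]_N) : Prop :=
  forall w : 'I_N,
    is_derive t 1 (fun u : R => complex.Re (psi u w 0)) (complex.Re (dpsi w 0)) /\
    is_derive t 1 (fun u : R => complex.Im (psi u w 0)) (complex.Im (dpsi w 0)).

(* i dpsi/dt = H psi with psi(0) = psi0 *)
Definition schrodinger_solution (R : realType) (N : nat)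
    (H : 'M[R[i]]_N) (psi0 : 'cV[R[i]]_N) (psi : R -> 'cV[R[i]]_N) : Prop :=
  psi 0 = psi0 /\
  forall t : R, exists2 dpsi : 'cV[R[i]]_N,
    is_vderive psi t dpsi & 'i%C *: dpsi = H *m psi t.

Definition outcome_prob (R : realType) (N : nat)
    (psi : 'cV[R[i]]_N) (w : 'I_N) : R :=
  ComplexField.Normc.normc ((((ket R w) ^t*) *m psi) 0 0) ^+ 2.

Section SearchInstance.
Variables (R : realType) (I : search_instance R).

Definition info_union : {set 'I_(db_size I)} :=
  \bigcup_(j < nb_info I) info j.

Definition basic_confidence : Prop :=
  forall j : 'I_(nb_info I), info j :&: target I != finset.set0.

Definition raw_state : 'cV[R[i]]_(db_size I) :=
  \sum_(j < nb_info I) (alpha j)%:C *: \sum_(w in info j) ket R w.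

Definition nu : R := hnorm raw_state.

Definition initial_state : 'cV[R[i]]_(db_size I) := (nu^-1)%:C *: raw_state.

Definition beta (w : 'I_(db_size I)) : R :=
  nu^-1 * \sum_(j < nb_info I | w \in info j) alpha j.

Definition overlap : R := Num.sqrt (\sum_(w in target I) beta w ^+ 2).

Definition target_space : {vspace 'cV[R[i]]_(db_size I)} :=
  <<[seq ket R w | w in target I]>>%VS.

Definition hamiltonian (E : R) : 'M[R[i]]_(db_size I) :=
  E%:C *: (\sum_(w in target I) ketbra (ket R w)) +
  E%:C *: ketbra initial_state.

Definition search_time (E : R) : R := pi / (2 * E * overlap).

(* The evolution started at the initial state lies in the target space at time
   T, and a measurement at that time returns a target with probability 1. *)
Definition search_completed_at (E T : R) : Prop :=
  forall psi : R -> 'cV[R[i]]_(db_size I),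
    schrodinger_solution (hamiltonian E) initial_state psi ->
    psi T \in target_space /\
    \sum_(w in target I) outcome_prob (psi T) w = 1.

End SearchInstance.

(* Main.v *)
(** The Hamiltonian has real coefficients, so the real and imaginary parts of
   a solution satisfy x' = h z, z' = - h x with h real symmetric; such a flow
   preserves the Euclidean norm, hence is determined by its initial value.
   With |tau> the normalised projection of |s> onto the target space and y the
   overlap, H |s> = E |s> + E y |tau> and H |tau> = E |tau> + E y |s>, so that
   psi(t) = e^(-iEt) (cos (Eyt) |s> - i sin (Eyt) |tau>), and the |s> component
   vanishes when Eyt = pi/2.
   For the time bound, nu^2 <= l + R because every unnormalised coefficient is
   at most sum alpha_j = 1; and since each A_j meets the target,
   (nu y)^2 >= sum alpha_j^2 >= 1/n by Cauchy-Schwarz.  Hence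
   1 <= n (l + R) y^2. *)
Require Import Defs.
From mathcomp Require Import all_boot all_order all_algebra.
From mathcomp Require Import all_classical all_reals all_analysis.
From mathcomp Require Import complex ring lra.
Set Implicit Arguments.
Unset Strict Implicit.
Unset Printing Implicit Defensive.
Import Order.TTheory GRing.Theory Num.Theory.
Import numFieldNormedType.Exports.
Local Open Scope classical_set_scope.
Local Open Scope ring_scope.

(** * Inequalities on finite sums, and uniqueness for symmetric linear flows *)

Lemma sum_sqr_le_sqr_sum (R : realDomainType) (J : finType) (P : pred J)
    (F : J -> R) : (forall j, 0 <= F j) ->
  \sum_(j | P j) F j ^+ 2 <= (\sum_(j | P j) F j) ^+ 2.
Proof.
move=> F0; suff [] : 0 <= \sum_(j | P j) F j /\
  \sum_(j | P j) F j ^+ 2 <= (\sum_(j | P j) F j) ^+ 2 by [].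
elim/big_rec2 : _ => [|j s2 s1 _ [s1_ge0 le_s2]]; first by rewrite expr0n.
have := F0 j; split; nra.
Qed.

(** The deviations of [F] from its mean, scaled by [n] to avoid division, have a nonnegative sum of
    squares. *)
Lemma sqr_sum_le_card_sum_sqr (R : realFieldType) (n : nat) (F : 'I_n -> R) :
  (0 < n)%N -> (\sum_j F j) ^+ 2 <= n%:R * \sum_j F j ^+ 2.
Proof.
move=> n0; set s := \sum_j F j.
have n0' : 0 < n%:R :> R by rewrite ltr0n.
have : 0 <= \sum_j (n%:R * F j - s) ^+ 2 by apply: sumr_ge0 => j _; exact: sqr_ge0.
have sqrE j : (n%:R * F j - s) ^+ 2 =
    n%:R ^+ 2 * F j ^+ 2 - (2 * n%:R * s) * F j + s ^+ 2 by ring.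
have -> : \sum_j (n%:R * F j - s) ^+ 2 =
    n%:R * (n%:R * \sum_j F j ^+ 2 - s ^+ 2).
  under eq_bigr => j _ do rewrite sqrE.
  rewrite big_split sumrB /= -!mulr_sumr sumr_const card_ord -/s.
  by rewrite -[_ *+ n]mulr_natl; ring.
by rewrite pmulr_rge0 // subr_ge0.
Qed.

Lemma symmetric_flow_unique0 (R : realType) (N : nat) (h : 'I_N -> 'I_N -> R)
    (x z : 'I_N -> R -> R) :
  (forall w v, h w v = h v w) ->
  (forall t w, is_derive t (1 : R) (x w) (\sum_v h w v * z v t)) ->
  (forall t w, is_derive t (1 : R) (z w) (- \sum_v h w v * x v t)) ->
  (forall w, x w 0 = 0) -> (forall w, z w 0 = 0) ->
  forall t w, x w t = 0 /\ z w t = 0.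
Proof.
move=> hsym dx dz x0 z0 t w.
(* The squared Euclidean norm, conserved by the flow; it is a sum of functions so that
   [is_derive_sum] applies directly. *)
pose q : R -> R := \sum_w (x w ^+ 2 + z w ^+ 2).
have qE u : q u = \sum_w (x w u ^+ 2 + z w u ^+ 2) by rewrite /q fct_sumE.
have q'0 (u : R) : is_derive u (1 : R) q 0.
  have dq v : is_derive u (1 : R) (x v ^+ 2 + z v ^+ 2)
      (2 * x v u * (\sum_v' h v v' * z v' u) -
       2 * z v u * (\sum_v' h v v' * x v' u)).
    apply: is_derive_eq.
    by rewrite /= !expr1 /GRing.scale /= mulrN.
  apply: is_derive_eq (is_derive_sum dq) _.
  rewrite sumrB; apply/eqP; rewrite subr_eq0; apply/eqP.
  under eq_bigr => v _ do rewrite mulr_sumr.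
  under [RHS]eq_bigr => v _ do rewrite mulr_sumr.
  (* The two double sums differ by a transposition of [h], so symmetry cancels them. *)
  rewrite exchange_big /=; apply: eq_bigr => v _; apply: eq_bigr => v' _.
  by rewrite hsym; ring.
have qt0 : q t = 0.
  rewrite (is_derive_0_is_cst t 0 q'0) qE big1 // => v _.
  by rewrite x0 z0 expr0n addr0.
have := psumr_eq0P (fun v _ => addr_ge0 (sqr_ge0 (x v t)) (sqr_ge0 (z v t))).
rewrite qE in qt0; move=> /(_ xpredT qt0 w isT)/eqP.
by rewrite paddr_eq0 ?sqr_ge0// !sqrf_eq0 => /andP[/eqP -> /eqP ->].
Qed.

Lemma normc_real (R : realType) (a : R) : ComplexField.Normc.normc a%:C%C ^+ 2 = a ^+ 2.
Proof. by rewrite /= expr0n addr0 sqr_sqrtr ?sqr_ge0. Qed.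

(** * Amplitudes of the initial state and lower bound on the overlap *)

Section Amplitudes.
Variables (R : realType) (I : search_instance R).
Local Notation N := (db_size I).
Local Notation T := (target I).

(* [nu] times the paper's [beta w], so that no division is involved. *)
Definition weight (w : 'I_N) : R := \sum_(j < nb_info I | w \in info j) alpha j.

Lemma weight_ge0 w : 0 <= weight w.
Proof. by apply: sumr_ge0 => j _; exact/ltW/alpha_gt0. Qed.

Lemma weight_le1 w : weight w <= 1.
Proof.
rewrite -(alpha_sum1 I) /weight big_mkcond; apply: ler_sum => j _.
by case: ifP => // _; exact/ltW/alpha_gt0.
Qed.

Lemma weight_out w : w \notin info_union I -> weight w = 0.
Proof.
move=> wU; rewrite /weight big_pred0 // => j; apply: contraNF wU => wj.
by apply/bigcupP; exists j.
Qed.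

Lemma raw_stateE w : raw_state I w 0 = (weight w)%:C%C.
Proof.
rewrite /raw_state summxE /weight rmorph_sum /= [RHS]big_mkcond.
apply: eq_bigr => j _; rewrite mxE summxE.
have [wj|wj] := boolP (w \in info j).
  rewrite (bigD1 w) //= big1 ?addr0 => [|v /andP[_ vw]]; last first.
    by rewrite mxE eq_sym (negbTE vw).
  by rewrite mxE !eqxx mulr1.
rewrite big1 ?mulr0 // => v vj; rewrite mxE.
by case: eqP => // wv; rewrite wv vj in wj.
Qed.

Lemma nu_ge0 : 0 <= nu I. Proof. exact: sqrtr_ge0. Qed.

Lemma nu_sqr : nu I ^+ 2 = \sum_w weight w ^+ 2.
Proof.
rewrite /nu /hnorm sqr_sqrtr; last by apply: sumr_ge0 => w _; exact: sqr_ge0.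
by apply: eq_bigr => w _; rewrite raw_stateE normc_real.
Qed.

Lemma initial_stateE w : initial_state I w 0 = (beta w)%:C%C.
Proof. by rewrite mxE raw_stateE -rmorphM. Qed.

Lemma nu_sqr_le_card : nu I ^+ 2 <= #|info_union I|%:R.
Proof.
rewrite nu_sqr -sum1_card natr_sum [leRHS]big_mkcond /=.
apply: ler_sum => w _; case: ifPn => [_|/weight_out ->]; last by rewrite expr0n.
by rewrite -(expr1n R 2) lerXn2r ?nnegrE ?weight_ge0 ?weight_le1.
Qed.

Lemma overlap_sqr : overlap I ^+ 2 = \sum_(w in T) beta w ^+ 2.
Proof. by rewrite sqr_sqrtr //; apply: sumr_ge0 => w _; exact: sqr_ge0. Qed.

Hypothesis confidence : basic_confidence I.

Lemma target_weight_ge : 1 <= (nb_info I)%:R * \sum_(w in T) weight w ^+ 2.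
Proof.
apply: (@le_trans _ _ ((nb_info I)%:R * \sum_(j < nb_info I) alpha j ^+ 2)).
  by have := sqr_sum_le_card_sum_sqr (@alpha R I) (nb_info_gt0 I);
    rewrite alpha_sum1 expr1n.
apply: ler_wpM2l => //.
(* Only the diagonal terms of each squared weight are kept. After exchanging the sums, each
   [alpha j ^+ 2] occurs once per target in [info j], hence at least once by confidence. *)
apply: (@le_trans _ _ (\sum_(w in T) \sum_(j | w \in info j) alpha j ^+ 2)).
  rewrite (exchange_big_dep predT) //=; apply: ler_sum => j _.
  have /finset.set0Pn[w] := confidence j; rewrite inE => /andP[wj wT].
  rewrite (bigD1 w) /= ?wT ?wj // lerDl.
  by apply: sumr_ge0 => v _; exact: sqr_ge0.
apply: ler_sum => w _.
by apply: sum_sqr_le_sqr_sum => j; exact/ltW/alpha_gt0.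
Qed.

(** If [nu] vanished, so would every weight, against [target_weight_ge]. Thus [nu^-1] is a true
    inverse and not the default value at zero. *)
Lemma nu_gt0 : 0 < nu I.
Proof.
rewrite lt0r nu_ge0 andbT -sqrf_eq0 nu_sqr.
apply/eqP => /psumr_eq0P s0.
have := target_weight_ge; rewrite big1 ?mulr0 ?ler10 // => w _.
by apply: s0 => // v _; exact: sqr_ge0.
Qed.

Lemma beta_norm1 : \sum_(w < N) beta w ^+ 2 = 1 :> R.
Proof.
under eq_bigr => w _ do rewrite /beta -/(weight w) exprMn.
by rewrite -mulr_sumr -nu_sqr exprVn mulVf // sqrf_eq0 gt_eqF // nu_gt0.
Qed.

(** The right-hand side factors into two quantities that are each at least 1. Being free of division
    by the overlap, this form also yields [overlap_gt0]. *)
Lemma overlap_ge : 1 <= (nb_info I)%:R * #|info_union I|%:R * overlap I ^+ 2.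
Proof.
rewrite overlap_sqr.
under eq_bigr => w _ do rewrite /beta -/(weight w) exprMn.
rewrite -mulr_sumr exprVn.
have nu2 : 0 < nu I ^+ 2 by rewrite exprn_gt0 // nu_gt0.
have le1 : 1 <= #|info_union I|%:R / nu I ^+ 2 :> R.
  by rewrite ler_pdivlMr // mul1r nu_sqr_le_card.
have := target_weight_ge; set S := \sum_(w in T) _ => le2.
have -> : (nb_info I)%:R * #|info_union I|%:R * ((nu I ^+ 2)^-1 * S) =
  (#|info_union I|%:R / nu I ^+ 2) * ((nb_info I)%:R * S) by ring.
by rewrite mulr_ege1.
Qed.

Lemma overlap_gt0 : 0 < overlap I.
Proof.
rewrite lt0r sqrtr_ge0 andbT; apply/eqP => y0.
by have := overlap_ge; rewrite y0 expr0n mulr0 ler10.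
Qed.

End Amplitudes.

Lemma ketbraE (R : realType) (N : nat) (v : 'cV[R[i]%C]_N) (i j : 'I_N) :
  ketbra v i j = v i 0 * (v j 0)^*.
Proof. by rewrite mxE big_ord1 !mxE. Qed.

Lemma conj_real_complex (R : realType) (a : R) :
  Num.conj (a%:C%C : R[i]%C) = a%:C%C.
Proof. by apply/conj_Creal; rewrite complex_real. Qed.

(** * Explicit solution of the Schrodinger equation and the search time *)

Section Dynamics.
Variables (R : realType) (I : search_instance R) (E : R).
Local Notation N := (db_size I).
Local Notation T := (target I).
Local Notation y := (overlap I).

Definition hcoef (w v : 'I_N) : R :=
  E * ((w == v) && (w \in T))%:R + E * (beta w * beta v).

Lemma hcoef_sym w v : hcoef w v = hcoef v w.
Proof.
by rewrite /hcoef eq_sym [beta w * _]mulrC; case: eqP => // ->.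
Qed.

Lemma hamiltonianE w v : hamiltonian I E w v = (hcoef w v)%:C%C.
Proof.
rewrite mxE [X in X + _]mxE [X in _ + X]mxE summxE ketbraE !initial_stateE.
rewrite conj_real_complex.
rewrite /hcoef rmorphD !rmorphM /=; congr (_ * _ + _).
under eq_bigr => u _ do rewrite ketbraE !mxE !andbT conjC_nat -natrM mulnb.
have [<-|wv] := eqVneq w v; last first.
  by rewrite big1 // => u _; case: eqP => //= <-; rewrite eq_sym (negbTE wv).
under eq_bigr => u _ do rewrite andbb.
have [wT|wT] := boolP (w \in T).
  rewrite (bigD1 w) //= eqxx big1 ?addr0 // => u /andP[_ uw].
  by rewrite eq_sym (negbTE uw).
by rewrite big1 // => u uT; case: eqP => // wu; rewrite wu uT in wT.
Qed.

Lemma schrodinger_Re_Im psi t w :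
  schrodinger_solution (hamiltonian I E) (initial_state I) psi ->
  is_derive t (1 : R) (fun u => complex.Re (psi u w 0))
    (\sum_v hcoef w v * complex.Im (psi t v 0)) /\
  is_derive t (1 : R) (fun u => complex.Im (psi u w 0))
    (- \sum_v hcoef w v * complex.Re (psi t v 0)).
Proof.
move=> [_ /(_ t)[dpsi dpsiE]] /matrixP/(_ w 0); rewrite !mxE.
have [dRe dIm] := dpsiE w.
under eq_bigr => v _ do rewrite hamiltonianE.
case: (dpsi w 0) dRe dIm => a c /= dRe dIm eq_ac.
(* With derivative a + ic, the left side of the equation is -c + ia; its parts are compared with
   those of the real matrix applied to psi. *)
have eqRe : - c = \sum_v hcoef w v * complex.Re (psi t v 0).
  transitivity (complex.Re ('i%C * (a +i* c)%C)); first by rewrite /=; ring.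
  rewrite eq_ac raddf_sum; apply: eq_bigr => v _.
  by case: (psi t v 0) => p q /=; ring.
have eqIm : a = \sum_v hcoef w v * complex.Im (psi t v 0).
  transitivity (complex.Im ('i%C * (a +i* c)%C)); first by rewrite /=; ring.
  rewrite eq_ac raddf_sum; apply: eq_bigr => v _.
  by case: (psi t v 0) => p q /=; ring.
by rewrite -eqRe -eqIm opprK.
Qed.

Hypothesis confidence : basic_confidence I.

(* Coordinates of |s> projected onto the target space and normalised. *)
Definition tau (w : 'I_N) : R := if w \in T then beta w / y else 0.

Lemma overlap_neq0 : y != 0.
Proof. by rewrite gt_eqF // overlap_gt0. Qed.

Lemma tau_norm1 : \sum_(w in T) tau w ^+ 2 = 1.
Proof.
under eq_bigr => w wT do rewrite /tau wT exprMn.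
by rewrite -mulr_suml -overlap_sqr exprVn divff // sqrf_eq0 overlap_neq0.
Qed.

(** The Hamiltonian is E times the projection onto the target space plus a rank-one term along
    |s>. *)
Lemma hcoef_sum (f : 'I_N -> R) w : \sum_v hcoef w v * f v =
  E * (w \in T)%:R * f w + E * beta w * \sum_v beta v * f v.
Proof.
under eq_bigr => v _ do rewrite mulrDl.
rewrite big_split /= (bigD1 w) //= eqxx /= big1 ?addr0 => [|v vw].
  by rewrite mulr_sumr; congr (_ + _); apply: eq_bigr => v _; ring.
by rewrite eq_sym (negbTE vw) mulr0 mul0r.
Qed.

Lemma hcoef_beta w : \sum_v hcoef w v * beta v = E * y * tau w + E * beta w.
Proof.
rewrite hcoef_sum; under eq_bigr => v _ do rewrite -expr2.
rewrite beta_norm1 // mulr1 /tau; congr (_ + _).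
case: ifP => _ /=; last by ring.
by field; exact: overlap_neq0.
Qed.

(** The projection fixes |tau>, and the inner product of |s> with |tau> is y. With [hcoef_beta], the
    span of |s> and |tau> is invariant. *)
Lemma hcoef_tau w : \sum_v hcoef w v * tau v = E * tau w + E * y * beta w.
Proof.
rewrite hcoef_sum.
have -> : \sum_v beta v * tau v = y.
  rewrite (bigID (mem T)) /= [X in _ + X]big1 ?addr0 => [|v vT].
    under eq_bigr => v vT do rewrite /tau vT mulrA -expr2.
    by rewrite -mulr_suml -overlap_sqr expr2 mulfK // overlap_neq0.
  by rewrite /tau (negbTE vT) mulr0.
by rewrite /tau; case: ifP => _ /=; ring.
Qed.

(* Real and imaginary parts of
   e^(-iEt) (cos (Eyt) |s> - i sin (Eyt) |tau>). *)
Definition sol_re w (t : R) : R :=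
  cos (E * t) * cos (E * y * t) * beta w - sin (E * t) * sin (E * y * t) * tau w.
Definition sol_im w (t : R) : R :=
  - (sin (E * t) * cos (E * y * t) * beta w + cos (E * t) * sin (E * y * t) * tau w).

Lemma is_derive_sol_re w t :
  is_derive t (1 : R) (sol_re w) (\sum_v hcoef w v * sol_im v t).
Proof.
apply: is_derive_eq.
(* By linearity, only the images of [beta] and [tau] are needed. *)
have -> : \sum_v hcoef w v * sol_im v t =
    - (sin (E * t) * cos (E * y * t) * (\sum_v hcoef w v * beta v) +
       cos (E * t) * sin (E * y * t) * (\sum_v hcoef w v * tau v)).
  rewrite !mulr_sumr -big_split -sumrN; apply: eq_bigr => v _ /=.
  by rewrite /sol_im; ring.
by rewrite hcoef_beta hcoef_tau /GRing.scale /=; ring.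
Qed.

Lemma is_derive_sol_im w t :
  is_derive t (1 : R) (sol_im w) (- \sum_v hcoef w v * sol_re v t).
Proof.
apply: is_derive_eq.
have -> : \sum_v hcoef w v * sol_re v t =
    cos (E * t) * cos (E * y * t) * (\sum_v hcoef w v * beta v) -
    sin (E * t) * sin (E * y * t) * (\sum_v hcoef w v * tau v).
  rewrite !mulr_sumr -sumrB; apply: eq_bigr => v _.
  by rewrite /sol_re; ring.
by rewrite hcoef_beta hcoef_tau /GRing.scale /=; ring.
Qed.

Lemma schrodinger_solutionE psi t w :
  schrodinger_solution (hamiltonian I E) (initial_state I) psi ->
  psi t w 0 = (sol_re w t +i* sol_im w t)%C.
Proof.
move=> psi_sol.
have dpsi t' w' := schrodinger_Re_Im t' w' psi_sol.
(* The difference between [psi] and the explicit solution obeys the same linear system with zero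
   initial value. *)
have := @symmetric_flow_unique0 R N hcoef
  (fun w u => complex.Re (psi u w 0) - sol_re w u)
  (fun w u => complex.Im (psi u w 0) - sol_im w u) hcoef_sym.
case/(_ _ _ _ _ t w) => [t' w'|t' w'|w'|w'|/eqP + /eqP].
- have [dRe _] := dpsi t' w'; have dsol := is_derive_sol_re w' t'.
  apply: is_derive_eq; rewrite -sumrB; apply: eq_bigr => v _.
  by rewrite mulrBr.
- have [_ dIm] := dpsi t' w'; have dsol := is_derive_sol_im w' t'.
  apply: is_derive_eq; rewrite -opprD -sumrB; congr (- _).
  by apply: eq_bigr => v _; rewrite -mulrBr.
- rewrite psi_sol.1 initial_stateE /sol_re !mulr0 cos0 sin0 /=; ring.
- rewrite psi_sol.1 initial_stateE /sol_im !mulr0 cos0 sin0 /=; ring.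
rewrite !subr_eq0; by case: (psi t w 0) => p q /= /eqP -> /eqP ->.
Qed.

Lemma search_completed : 0 < E -> search_completed_at I E (search_time I E).
Proof.
move=> E0 psi psi_sol.
have Eyt : E * y * search_time I E = pi / 2.
  by rewrite /search_time; field; rewrite overlap_neq0 gt_eqF.
set t := search_time I E in Eyt *.
(* The cosine of pi/2 kills the |s> component, leaving |tau> times the phase -i e^(-iEt). *)
have psiE w : psi t w 0 =
    (- (sin (E * t) * tau w) +i* (- (cos (E * t) * tau w)))%C.
  rewrite schrodinger_solutionE // /sol_re /sol_im Eyt cos_pihalf sin_pihalf.
  by congr (_ +i* _)%C; ring.
have psi_ket : psi t = \sum_(w in T) psi t w 0 *: ket R w.
  apply/colP => w; rewrite summxE.
  have [wT|wT] := boolP (w \in T).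
    rewrite (bigD1 w) //= big1 ?addr0 => [|v /andP[_ vw]].
      by rewrite !mxE !eqxx mulr1.
    by rewrite !mxE eq_sym (negbTE vw) mulr0.
  rewrite psiE /tau (negbTE wT) !mulr0 !oppr0 big1 // => v vT.
  rewrite !mxE; case: eqP => [wv|_]; last by rewrite mulr0.
  by rewrite wv vT in wT.
split.
  rewrite psi_ket; apply: rpred_sum => w wT; apply/rpredZ/memv_span.
  by apply: map_f; rewrite mem_enum.
(* The phase has modulus one, so the outcome probabilities are the squares of [tau]. *)
rewrite -tau_norm1; apply: eq_bigr => w wT.
rewrite /outcome_prob mxE (bigD1 w) //= big1 ?addr0 => [|v vw]; last first.
  by rewrite !mxE (negbTE vw) conjC0 mul0r.
rewrite !mxE !eqxx conjC1 mul1r psiE /= sqr_sqrtr ?addr_ge0 ?sqr_ge0 //.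
by rewrite !sqrrN !exprMn -mulrDl addrC cos2Dsin2 mul1r.
Qed.

Lemma search_time_le : 0 < E -> search_time I E <=
  pi / (2 * E) * Num.sqrt ((nb_info I)%:R * #|info_union I|%:R).
Proof.
move=> E0; have y0 := overlap_gt0 confidence.
have -> : search_time I E = pi / (2 * E) * y^-1.
  by rewrite /search_time; field; rewrite overlap_neq0 gt_eqF.
apply: ler_wpM2l; first by rewrite divr_ge0 ?pi_ge0 ?mulr_ge0 // ltW.
(* Writing 1/y as the square root of its square reduces the bound to [overlap_ge]. *)
rewrite -[leLHS](ger0_norm (ltW _)) ?invr_gt0 // -sqrtr_sqr ler_wsqrtr //.
by rewrite exprVn -[leLHS]mul1r ler_pdivrMr ?exprn_gt0 // overlap_ge.
Qed.
End Dynamics.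

(** * Asymptotic bound along a family of instances *)

Theorem corollary3p2 (R : realType) (E K : R) (E_gt0 : 0 < E) (K_gt0 : 0 < K) :
  exists2 C : R, 0 < C &
  forall (delta : R) (I : nat -> search_instance R),
    0 < delta ->
    (fun k : nat => db_size (I k)) @ \oo --> \oo ->
    (forall k : nat, basic_confidence (I k)) ->
    (\forall k \near \oo,
       #|info_union (I k)|%:R <= K * (db_size (I k))%:R `^ delta) ->
    (forall k : nat, search_completed_at (I k) E (search_time (I k) E)) /\
    (\forall k \near \oo,
       search_time (I k) E <=
         C * ((nb_info (I k))%:R `^ (1 / 2) * (db_size (I k))%:R `^ (delta / 2))).
Proof.
(* The prefactor of [search_time_le], times the square root of K extracted from the bound on the
   union. *)
exists (pi / (2 * E) * Num.sqrt K).
  by rewrite mulr_gt0 ?sqrtr_gt0 // divr_gt0 ?pi_gt0 ?mulr_gt0.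
move=> delta I _ _ confidence small_union; split=> [k|].
  exact: search_completed.
near=> k.
have union_le : #|info_union (I k)|%:R <= K * (db_size (I k))%:R `^ delta.
  by near: k.
apply: le_trans (search_time_le (confidence k) E_gt0) _.
rewrite -[leRHS]mulrA; apply: ler_wpM2l; first by rewrite divr_ge0 ?pi_ge0 ?mulr_ge0 // ltW.
(* Both powers become square roots, so that all factors merge under a single root. *)
rewrite div1r powR12_sqrt // powRrM powR12_sqrt ?powR_ge0 //.
rewrite -!sqrtrM // ?(ltW K_gt0) //; apply: ler_wsqrtr.
by rewrite mulrCA; apply: ler_wpM2l.
Unshelve. all: by end_near.
Qed.
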